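(* Let $n$ be a positive integer and $\varepsilon \in (0,1/6)$ be any real number. Then there is a finite nonabelian group $H$ and a set $A_* \subset H$ with the following properties: (1) $|A_*| > n$ and $|A_* A_*| < 2|A_*|$; (2) for any $A \subseteq A_*$ with $|A| \ge |A_*|^{1-\varepsilon}$ and any finite group $G$ such that there exists a Freiman $5$-isomorphism from $A$ to a subset of $G$, we have $|G| \gg |A|^{1+\frac{1-6\varepsilon}{5}}$.
   Context: Let $G_1, G_2$ be groups, $A \subseteq G_1$, $B \subseteq G_2$, and $s \ge 2$ an integer. A map $\rho : A \to B$ is a Freiman $s$-homomorphism if for all $a_1,\dots,a_s,b_1,\dots,b_s \in A$ and all signs $\varepsilon_j \in \{-1,1\}$, $a_1^{\varepsilon_1}\cdots a_s^{\varepsilon_s} = b_1^{\varepsilon_1}\cdots b_s^{\varepsilon_s}$ implies $\rho(a_1)^{\varepsilon_1}\cdots\rho(a_s)^{\varepsilon_s} = \rho(b_1)^{\varepsilon_1}\cdots\rho(b_s)^{\varepsilon_s}$. If moreover $\rho$ is bijective onto $B$ and $\rho^{-1}$ is also a Freiman $s$-homomorphism, then $\rho$ is a Freiman $s$-isomorphism. $A_*A_* = \{xy : x,y\in A_*\}$. The notation $X \gg Y$ means $X \ge CY$ for some constant $C>0$. *)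

(* Defs.v *)
From HB Require Import structures.
From mathcomp Require Import all_boot all_order all_algebra all_fingroup.

Set Implicit Arguments.
Unset Strict Implicit.
Unset Printing Implicit Defensive.

(* A sign is encoded by a boolean, with true standing for the exponent -1. *)
Definition signed_pow (G : groupType) (x : G) (e : bool) : G :=
  if e then (x^-1)%g else x.

(* A map rho : A -> B between subsets is represented by a function on the
   ambient group, of which only the values on A are constrained. *)
Definition freiman_hom (s : nat) (G1 G2 : groupType)
    (A : {pred G1}) (B : {pred G2}) (rho : G1 -> G2) : Prop :=
  {in A, forall x, rho x \in B} /\
  forall (a b : 'I_s -> G1) (e : 'I_s -> bool),
    (forall j, a j \in A) -> (forall j, b j \in A) ->
    (\prod_(j < s) signed_pow (a j) (e j)
       = \prod_(j < s) signed_pow (b j) (e j))%g ->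
    (\prod_(j < s) signed_pow (rho (a j)) (e j)
       = \prod_(j < s) signed_pow (rho (b j)) (e j))%g.

Definition freiman_iso (s : nat) (G1 G2 : groupType)
    (A : {pred G1}) (B : {pred G2}) (rho : G1 -> G2) : Prop :=
  freiman_hom s A B rho /\
  exists sigma : G2 -> G1,
    [/\ {in A, cancel rho sigma}, {in B, cancel sigma rho}
      & freiman_hom s B A sigma].

(* Main.v *)
(** Take H = Sym(F_p) and let A_* consist of the affine maps x |-> g^i x + b with i < m, where g
    generates F_p^* and m is about p^beta.  If rho is a Freiman 5-isomorphism from a large A into G,
    a second-moment count shows that products a1 a2 a3 with a suitable fixed slope realise every
    translation part; comparing with a1 a2 a3 c^-1 d gives a homomorphic embedding of (F_p, +) in G
    which rho(a) normalises, acting by multiplication by the slope of a.  Hence the slopes of A lie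
    in a subgroup Lam of F_p^* with p |Lam| <= |G|.  As a subgroup of a cyclic group, Lam contains
    few of the powers g^i with i < m unless it is large, so |A| <= 2 m |G| / (p - 1). *)
Require Import Defs.
From HB Require Import structures.
From mathcomp Require Import all_boot all_order all_algebra all_fingroup all_solvable.
From mathcomp Require Import reals exp zify ring lra.

Set Implicit Arguments.
Unset Strict Implicit.
Unset Printing Implicit Defensive.

Import Order.TTheory GRing.Theory Num.Theory.

Local Open Scope ring_scope.

(** * Sums of dilates in a finite field *)

Section DilateSums.
Variables (F : finFieldType) (X : {set F}).

Definition dilate_sum (l : {unit F}) (z : F * F) : F := z.1 + val l * z.2.

(** Fix z. The pair z' = z collides for all q - 1 dilations, where q = |F|. A point z' differing
    from z in both coordinates collides for at most one l, and one differing in a single coordinate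
    for none. *)
Lemma sum_dilate_energy :
  (\sum_(l : {unit F}) \sum_(z in setX X X) \sum_(z' in setX X X)
     (dilate_sum l z' == dilate_sum l z)
   <= #|X| ^ 2 * (#|F|.-1 + #|X|.-1 ^ 2))%N.
Proof.
rewrite exchange_big /=.
have -> : (#|X| ^ 2 = #|setX X X|)%N by rewrite cardsX mulnn.
rewrite -sum_nat_const; apply: leq_sum => z zX.
rewrite exchange_big /= (bigD1 z) //=; apply: leq_add.
  under eq_bigr do rewrite eqxx.
  by rewrite sum_nat_const muln1 -card_finField_unit cardsT.
move: zX; rewrite inE => /andP[z1X z2X].
have -> : (#|X|.-1 ^ 2 = #|setX (X :\ z.1) (X :\ z.2)|)%N.
  rewrite cardsX (cardsD1 z.1 X) z1X add1n /= expnS expn1; congr (_ * _)%N.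
  by move: (cardsD1 z.1 X) (cardsD1 z.2 X); rewrite z1X z2X => -> /eqP; rewrite eqSS => /eqP.
rewrite -sum1_card (bigID [pred z' | z' \in setX (X :\ z.1) (X :\ z.2)]) /=.
rewrite [X in (_ + X)%N]big1 ?addn0.
  rewrite (eq_bigl [in setX (X :\ z.1) (X :\ z.2)]); last first.
    move=> [x y]; rewrite !inE /=; case: z {z1X z2X} => a b /=.
    by rewrite -pair_eqE /=; do 2![case: eqP => //= _]; rewrite ?andbF // ?andbT andbb.
  apply: leq_sum => -[x y]; rewrite !inE /= => /andP[/andP[xz xX] /andP[yz yX]].
  have [/existsP[l /eqP El]|/existsPn ne] :=
      boolP [exists l, dilate_sum l (x, y) == dilate_sum l z]; last first.
    by rewrite big1 // => l _; rewrite (negPf (ne l)).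
  rewrite (bigD1 l) //= big1 ?addn0 ?leq_b1 // => l' l'l.
  apply/eqP; rewrite eqb0; apply: contra l'l => /eqP El'.
  have yz0 : y - z.2 != 0 by rewrite subr_eq0.
  rewrite -val_eqE /=; apply/eqP; apply: (mulIf yz0).
  have diff u : dilate_sum u (x, y) = dilate_sum u z -> val u * (y - z.2) = z.1 - x.
    by rewrite /dilate_sum mulrBr /= => e; apply/eqP; rewrite subr_eq addrAC -e addrAC subrr add0r.
  by rewrite (diff l El) (diff l' El').
move=> [x y]; rewrite !inE /= => /andP[/andP[/andP[xX yX] xyz]].
rewrite xX yX !andbT => xyz'.
rewrite big1 // => l _; apply/eqP; rewrite eqb0 /dilate_sum /=.
have l0 : val l != 0 by rewrite -unitfE; exact: (valP l).
move: xyz; case: z {z1X z2X} xyz' => a b /=; rewrite -pair_eqE /=.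
case: (x =P a) => [->|/eqP xa] /=; case: (y =P b) => [->|/eqP yb] //= _ _.
  by apply: contra yb => /eqP/addrI/(mulfI l0) ->.
by apply: contra xa => /eqP/addIr ->.
Qed.

(* Second moment: the number of representations of n as x + l y has mean |X|^2/q over n, and it
   vanishes on a translate of - T l when X + l X + T l misses a point; averaging over l bounds
   the sum of |T l|. *)
Lemma dilate_cover (T : {unit F} -> {set F}) :
  (#|F| ^ 3 < #|X| ^ 2 * \sum_l #|T l|)%N ->
  exists l : {unit F}, forall n, exists x y t,
    [/\ x \in X, y \in X, t \in T l & n = x + val l * y + t].
Proof.
move=> big; set q := #|F|; set N := #|X|.
pose r l n := (\sum_(z in setX X X) (dilate_sum l z == n))%N.
pose miss l n := [forall t in T l, r l (n - t) == 0%N].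
(* Either some l misses no point and is the witness, or every l misses one; the rest refutes the
   second case. *)
have [/existsP[l /existsPn hit]|/existsPn all_miss] :=
    boolP [exists l, ~~ [exists n, miss l n]].
  exists l => n; move: (hit n) => /forall_inPn[t tT].
  rewrite -lt0n lt0n sum_nat_eq0 => /forall_inPn[[x y]].
  rewrite !inE /= eqb0 negbK => /andP[xX yX] /eqP e.
  by exists x, y, t; split => //; rewrite -[RHS]/(dilate_sum l (x, y) + t) e subrK.
have Nq : (N <= q)%N by exact: max_card.
have sumr l : (\sum_n r l n = N ^ 2)%N.
  rewrite exchange_big /=; under eq_bigr => z _.
    rewrite (bigD1 (dilate_sum l z)) //= eqxx big1 ?addn0; last first.
      by move=> n /negPf; rewrite eq_sym => ->.
    over.
  by rewrite sum1_card cardsX mulnn.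
have sumr2 l : (\sum_n r l n ^ 2 = \sum_(z in setX X X) \sum_(z' in setX X X)
     (dilate_sum l z' == dilate_sum l z))%N.
  under eq_bigr => n _ do rewrite expnS expn1 {2}/r big_distrr /=.
  rewrite exchange_big /=; apply: eq_bigr => z _.
  rewrite (bigD1 (dilate_sum l z)) //= eqxx muln1 big1 ?addn0 // => n.
  by rewrite eq_sym => /negPf ->; rewrite muln0.
(* Here [r l] vanishes on the |T l| points n - t, so each of them contributes N^4 to the variance,
   the sum over m of (q r(m) - N^2)^2. *)
have per l : ((#|T l| + q) * N ^ 4 <= q ^ 2 * \sum_n r l n ^ 2)%N.
  have /negPn/existsP[n /forall_inP mis] := all_miss l.
  rewrite -(ler_nat int).
  have : \sum_m (q%:R * (r l m)%:R - (N ^ 2)%:R) ^+ 2 =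
     q%:R ^+ 2 * (\sum_n r l n ^ 2)%N%:R - q%:R * (N ^ 4)%:R :> int.
    transitivity (\sum_m (q%:R ^+ 2 * (r l m ^ 2)%N%:R
        - 2%:R * q%:R * (N ^ 2)%N%:R * (r l m)%:R + (N ^ 4)%N%:R : int)).
      by apply: eq_bigr => m _; rewrite !natrX; ring.
    rewrite big_split sumrB /= -!mulr_sumr -!natr_sum sumr sumr_const cardT -cardE -/q.
    by rewrite -[_ *+ q]mulr_natl !natrX; ring.
  have : (#|T l| * N ^ 4)%N%:R <= \sum_m (q%:R * (r l m)%:R - (N ^ 2)%:R) ^+ 2 :> int.
    have injn : injective (fun t => n - t) by move=> t t' /addrI/oppr_inj.
    rewrite -(card_imset (T l) injn) natrM mulr_natl -sumr_const.
    rewrite [leRHS](bigID [in [set n - t | t in T l]]) /= -[leLHS]addr0.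
    apply: lerD; last by apply: sumr_ge0 => m _; exact: sqr_ge0.
    apply: ler_sum => _ /imsetP[t tT ->]; rewrite (eqP (mis t tT)) mulr0 sub0r sqrrN.
    by rewrite -natrX -expnM.
  move=> le1 eq1; move: le1; rewrite eq1 lerBrDr.
  by rewrite -!natrM -natrX -natrM -natrD -mulnDl.
have tot : ((\sum_l #|T l| + q * q.-1) * N ^ 4
     <= q ^ 2 * (N ^ 2 * (q.-1 + N.-1 ^ 2)))%N.
  apply: leq_trans (leq_mul (leqnn _) sum_dilate_energy).
  rewrite (eq_bigr _ (fun l _ => esym (sumr2 l))) big_distrr /=.
  apply: leq_trans (leq_sum _ (fun l _ => per l)).
  by rewrite -big_distrl /= big_split /= sum_nat_const -cardsT card_finField_unit [(q * _)%N]mulnC.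
have N0 : (0 < N)%N by rewrite lt0n; apply: contraTneq big; rewrite -/N => ->; rewrite -leqNgt.
have q0 : (0 < q)%N by exact: leq_trans Nq.
move: tot; rewrite -/q -/N; set S := (\sum_l _)%N.
have -> : (N ^ 4 = N ^ 2 * N ^ 2)%N by rewrite -expnD.
rewrite mulnA (mulnCA (q ^ 2)%N) [leqRHS]mulnC leq_pmul2r ?expn_gt0 ?N0 //.
rewrite -/q -/N -/S in big.
move: Nq N0 q0 big; case: (N) => // M; case: (q) => // p /= Mp _ _ big tot.
(* With q = p + 1 and N = M + 1, this inequality reduces to 2 q N < N^2, impossible since N <= q. *)
suff : (p.+1 * (p.+1 ^ 2 + p * M.+1 ^ 2) < p.+1 * (p.+1 * (p + M ^ 2)))%N.
  by rewrite ltn_pmul2l // => {big tot}; nia.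
by lia.
Qed.

End DilateSums.

(** * Affine permutations of a finite field *)

Lemma val_unit_neq0 (F : finFieldType) (u : {unit F}) : val u != 0.
Proof. by rewrite -unitfE; exact: (valP u). Qed.

Section Affine.
Variable F : finFieldType.
Implicit Types (u v : {unit F}) (b c t : F).

Definition affine_fun u b (x : F) := val u * x + b.

Lemma affine_fun_inj u b : injective (affine_fun u b).
Proof. by move=> x y /addIr/(mulfI (val_unit_neq0 u)). Qed.

Definition affine u b : {perm F} := perm (@affine_fun_inj u b).

Lemma affineE u b x : affine u b x = val u * x + b.
Proof. by rewrite permE. Qed.

(** Permutations compose from left to right, so [affine u b] acts first. *)
Lemma affineM u b v c : (affine u b * affine v c)%g = affine (u * v)%g (val v * b + c).
Proof.
by apply/permP=> x; rewrite permM !affineE /= mulrDr mulrCA -mulrA addrA mulrCA.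
Qed.

Lemma affine_inj2 u b v c : affine u b = affine v c -> u = v /\ b = c.
Proof.
move=> /permP e; have := e 0; rewrite !affineE !mulr0 !add0r => ebc.
by split=> //; have := e 1; rewrite !affineE !mulr1 ebc => /addIr/val_inj.
Qed.

Lemma affine_div u b t : ((affine u b)^-1 * affine u (b + t))%g = affine 1%g t.
Proof.
apply: (mulgI (affine u b)); rewrite mulKVg affineM mulg1.
by congr affine; rewrite /= mul1r.
Qed.

Lemma affine_conj u b t : (affine 1%g t ^ affine u b)%g = affine 1%g (val u * t).
Proof.
apply: (mulgI (affine u b)); rewrite conjgE mulKVg !affineM mul1g mulg1.
by congr affine; rewrite /= mul1r addrC.
Qed.

Definition fiber (A : {set {perm F}}) u := [set b | affine u b \in A].

Lemma card_fibers (A : {set {perm F}}) :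
  (forall a, a \in A -> exists u b, a = affine u b) -> #|A| = (\sum_u #|fiber A u|)%N.
Proof.
move=> Aaff; pose f (z : {unit F} * F) := affine z.1 z.2.
have finj : injective f by case=> u b [v c] /affine_inj2[/= -> ->].
have {1}-> : A = f @: (f @^-1: A).
  apply/setP=> a; apply/idP/imsetP=> [aA|[z + ->]]; last by rewrite inE.
  by have [u [b ea]] := Aaff a aA; exists (u, b); rewrite // inE /f /= -ea.
rewrite card_imset // -sum1_card; under [RHS]eq_bigr do rewrite -sum1_card.
by rewrite pair_big_dep /=; apply: eq_bigl => -[u b] /=; rewrite !inE.
Qed.

End Affine.

(** Pigeonhole: (x, y) |-> u x + y cannot be injective on X * X. A collision with x = x' would force
    y = y'. *)
Lemma dilate_difference (F : finFieldType) (X : {set F}) (u : {unit F}) :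
  (#|F| < #|X| ^ 2)%N ->
  exists x x' y y',
    [/\ x \in X, x' \in X, y \in X, y' \in X & x' != x /\ y' - y = val u * (x' - x)].
Proof.
move=> big; pose f (z : F * F) := val u * z.1 + z.2.
have : ~~ [forall z in setX X X, forall z' in setX X X, (f z == f z') ==> (z == z')].
  apply: contraTN big => /forall_inP inj; rewrite -leqNgt -mulnn -cardsX.
  rewrite -(card_in_imset (f := f)) ?max_card // => z z' zX z'X /eqP e.
  by apply/eqP; move/forall_inP: (inj z zX) => /(_ z' z'X); rewrite e.
case/forall_inPn => -[x y] + /forall_inPn[[x' y']].
rewrite !inE /= => /andP[xX yX] /andP[x'X y'X]; rewrite negb_imply => /andP[/eqP].
rewrite /f /= -pair_eqE /= => e ne; exists x, x', y', y; split=> //.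
have e2 : y - y' = val u * (x' - x).
  by rewrite mulrBr; apply/eqP; rewrite subr_eq addrAC -e addrAC subrr add0r.
split => //; apply: contraNneq ne => ex; move: e2; rewrite ex subrr mulr0 eqxx /=.
by move/eqP; rewrite subr_eq0.
Qed.

(** * Short words transported by a Freiman homomorphism *)

Section FreimanWords.
Variables (G1 G2 : groupType) (A : {pred G1}) (B : {pred G2}) (rho : G1 -> G2).
Hypothesis rho_hom : freiman_hom 5 A B rho.

Lemma freiman_word5 (e1 e2 e3 e4 e5 : bool) a1 a2 a3 a4 a5 b1 b2 b3 b4 b5 :
  all [in A] [:: a1; a2; a3; a4; a5] -> all [in A] [:: b1; b2; b3; b4; b5] ->
  (signed_pow a1 e1 * signed_pow a2 e2 * signed_pow a3 e3 * signed_pow a4 e4 * signed_pow a5 e5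
   = signed_pow b1 e1 * signed_pow b2 e2 * signed_pow b3 e3 * signed_pow b4 e4
     * signed_pow b5 e5)%g ->
  (signed_pow (rho a1) e1 * signed_pow (rho a2) e2 * signed_pow (rho a3) e3
     * signed_pow (rho a4) e4 * signed_pow (rho a5) e5
   = signed_pow (rho b1) e1 * signed_pow (rho b2) e2 * signed_pow (rho b3) e3
     * signed_pow (rho b4) e4 * signed_pow (rho b5) e5)%g.
Proof.
set a := [:: a1; a2; a3; a4; a5]; set b := [:: b1; b2; b3; b4; b5] => aA bA.
have := rho_hom.2 (nth a1 a) (nth a1 b) (nth false [:: e1; e2; e3; e4; e5]).
rewrite !big_ord_recl !big_ord0 /= !mulg1 !mulgA; apply => j.
- by apply: (allP aA); rewrite mem_nth.
- by apply: (allP bA); rewrite mem_nth.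
Qed.

Local Open Scope group_scope.

(** This pattern needs all five letters: a three-letter word is corrected by a quotient c^-1 d,
    which is a translation when c and d have equal slope. *)
Lemma freiman_word32 a1 a2 a3 c d b1 b2 b3 c' d' :
  all [in A] [:: a1; a2; a3; c; d] -> all [in A] [:: b1; b2; b3; c'; d'] ->
  a1 * a2 * a3 * (c^-1 * d) = b1 * b2 * b3 * (c'^-1 * d') ->
  rho a1 * rho a2 * rho a3 * ((rho c)^-1 * rho d)
    = rho b1 * rho b2 * rho b3 * ((rho c')^-1 * rho d').
Proof.
by rewrite !mulgA; exact: (@freiman_word5 false false false true false).
Qed.

Lemma freiman_word3 a1 a2 a3 b1 b2 b3 :
  all [in A] [:: a1; a2; a3] -> all [in A] [:: b1; b2; b3] ->
  a1 * a2 * a3 = b1 * b2 * b3 -> rho a1 * rho a2 * rho a3 = rho b1 * rho b2 * rho b3.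
Proof.
move=> /= /and4P[a1A a2A a3A _] /and4P[b1A b2A b3A _] e.
(* Both words are padded to length five with the same a1^-1 a1. *)
rewrite -[LHS]mulg1 -[RHS]mulg1 -(mulVg (rho a1)).
by apply: freiman_word32; rewrite /= ?e ?a1A ?a2A ?a3A ?b1A ?b2A ?b3A.
Qed.

Lemma freiman_word4 a c d b a' c' d' b' :
  all [in A] [:: a; c; d; b] -> all [in A] [:: a'; c'; d'; b'] ->
  a^-1 * c^-1 * d * b = a'^-1 * c'^-1 * d' * b' ->
  (rho a)^-1 * (rho c)^-1 * rho d * rho b = (rho a')^-1 * (rho c')^-1 * rho d' * rho b'.
Proof.
move=> sA sA' e; apply: (mulIg (rho a)).
have aA : a \in A by case/andP: sA.
apply: (@freiman_word5 true true false false false); last by rewrite /signed_pow e.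
  by rewrite -[[:: a; c; d; b; a]]/([:: a; c; d; b] ++ [:: a]) all_cat sA /= aA.
by rewrite -[[:: a'; c'; d'; b'; a]]/([:: a'; c'; d'; b'] ++ [:: a]) all_cat sA' /= aA.
Qed.

End FreimanWords.

(** * Recovering translations and slopes from a Freiman isomorphism *)

Lemma Fp_natmul p (x y : 'F_p) : x != 0 -> exists k, y = x *+ k.
Proof. by move=> x0; exists (y / x : 'F_p); rewrite -mulr_natl natr_Zp divfK. Qed.

(** The largest fiber X satisfies |A| <= |Y| |X|, hence |A|^3 <= |Y|^2 |X|^2 |A|; the second bound
    then follows from |A| <= |F|^2. The two bounds feed [dilate_cover] and [dilate_difference]
    respectively. *)
Lemma large_fiber (F : finFieldType) (Y : {set {unit F}}) (A : {set {perm F}}) :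
  (forall a, a \in A -> exists u b, u \in Y /\ a = affine u b) ->
  (#|F| ^ 3 * #|Y| ^ 2 < #|A| ^ 3)%N ->
  exists u, (#|F| ^ 3 < #|fiber A u| ^ 2 * #|A|)%N /\ (#|F| < #|fiber A u| ^ 2)%N.
Proof.
move=> AY big; pose u := [arg max_(v > 1%g : {unit F}) #|fiber A v|]; exists u.
have umax v : (#|fiber A v| <= #|fiber A u|)%N.
  by rewrite /u; case: arg_maxnP => // w _ /(_ v); exact.
have Aaff a : a \in A -> exists v b, a = affine v b by move=> /AY[v [b [_ ->]]]; exists v, b.
have leA : (#|A| <= #|Y| * #|fiber A u|)%N.
  rewrite (card_fibers Aaff) (bigID [in Y]) /= [X in (_ + X)%N]big1 ?addn0.
    by rewrite -sum_nat_const; apply: leq_sum => v _; exact: umax.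
  move=> v vY; apply: eq_card0 => b; rewrite !inE; apply: contraNF vY.
  by move=> /AY[w [c [wY /affine_inj2[-> _]]]].
have Y0 : (0 < #|Y|)%N.
  by case: (#|Y|) leA big => // ; rewrite mul0n leqn0 => /eqP ->; rewrite muln0.
have cube : (#|F| ^ 3 < #|fiber A u| ^ 2 * #|A|)%N.
  rewrite -(ltn_pmul2r (m := #|Y| ^ 2)) ?expn_gt0 ?Y0 //; apply: leq_trans big _.
  rewrite mulnAC -expnMn (mulnC _ #|Y|) (expnS _ 2) mulnC leq_mul2r leq_exp2r // leA; exact: orbT.
split=> //; have A2 : (#|A| <= #|F| ^ 2)%N.
  rewrite (card_fibers Aaff) -mulnn.
  apply: leq_trans (leq_mul (max_card [set u : F | u != 0]) (leqnn _)).
  have -> : #|[set u : F | u != 0]| = #|[set: {unit F}]|.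
    by rewrite card_finField_unit -(cardC1 0); apply: eq_card => x; rewrite !inE.
  by rewrite cardsT -sum_nat_const; apply: leq_sum => v _; exact: max_card.
have F0 : (0 < #|F| ^ 2)%N by rewrite expn_gt0; apply/orP; left; apply/card_gt0P; exists 0.
rewrite -(ltn_pmul2r F0) -expnS; apply: leq_trans cube _.
by rewrite leq_mul2l A2 orbT.
Qed.

Section Model.
Variables (p : nat) (A : {set {perm 'F_p}}) (Y : {set {unit 'F_p}}).
Hypothesis AY : forall a, a \in A -> exists u b, u \in Y /\ a = affine u b.
Hypothesis big : (#|'F_p| ^ 3 * #|Y| ^ 2 < #|A| ^ 3)%N.
Variables (G : finGroupType) (B : {set G}) (rho : {perm 'F_p} -> G).
Hypothesis rho_iso : freiman_iso 5 A B rho.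

(* Words a1 a2 a3 of a fixed slope represent every translation; mapping them by rho and comparing
   with words a1 a2 a3 c^-1 d yields an embedding v of the additive group into G. *)
Lemma translation_model :
  exists v : 'F_p -> G,
    [/\ injective v, {morph v : s t / s + t >-> (s * t)%g}
      & forall u b t, affine u b \in A -> affine u (b + t) \in A ->
          ((rho (affine u b))^-1 * rho (affine u (b + t)))%g = v t].
Proof.
have [rho_hom [sigma [rhoK _ sigma_hom]]] := rho_iso.
have rhoB := rho_hom.1.
have [u [cube sq]] := large_fiber AY big; set X := fiber A u in cube sq.
have Aaff a : a \in A -> exists v b, a = affine v b by move=> /AY[v [b [_ ->]]]; exists v, b.
(* The word with slopes u, l u^-1, u and translation parts y, t, x has slope u l and translation
   part x + l y + u t; hence the factor u in [T]. *)
pose T (l : {unit 'F_p}) := [set val u * t | t in fiber A (l * u^-1)%g].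
have sumT : (\sum_l #|T l| = #|A|)%N.
  rewrite (card_fibers Aaff) [RHS](reindex_inj (mulIg u^-1)%g); apply: eq_bigr => l _.
  by rewrite card_imset //; exact: mulfI (val_unit_neq0 u).
have [l cover] : exists l : {unit 'F_p}, forall n, exists x y t,
    [/\ x \in X, y \in X, t \in T l & n = x + val l * y + t].
  by apply: dilate_cover; rewrite sumT.
have {cover} /fin_all_exists[phi phiP] n : exists g, exists a1 a2 a3,
    [/\ all [in A] [:: a1; a2; a3], (a1 * a2 * a3)%g = affine (u * l)%g n
      & g = (rho a1 * rho a2 * rho a3)%g].
  have [x [y [_ [xX yX /imsetP[t tA ->] ->]]]] := cover n.
  move: xX yX tA; rewrite !inE => xX yX tA.
  exists (rho (affine u y) * rho (affine (l * u^-1) t) * rho (affine u x))%g.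
  exists (affine u y), (affine (l * u^-1)%g t), (affine u x); split=> //=.
    by rewrite xX yX tA.
  rewrite !affineM -mulgA mulgKV; congr affine.
  have -> : val l = val u * val (l * u^-1)%g.
    by rewrite mulrC -[RHS]/(val (l * u^-1 * u)%g) mulgKV.
  by rewrite mulrDr addrC addrA mulrA.
(* The word for n + t padded with c^-1 c equals the word for n followed by c^-1 d, where c and d
   have slope w and translation parts b and b + t. *)
have phi_shift w b t n : affine w b \in A -> affine w (b + t) \in A ->
    phi (n + t) = (phi n * ((rho (affine w b))^-1 * rho (affine w (b + t))))%g.
  move=> bA btA; have [a1 [a2 [a3 [aA ea ->]]]] := phiP n.
  have [b1 [b2 [b3 [b'A eb ->]]]] := phiP (n + t).
  rewrite -[LHS]mulg1 -[X in (_ * X)%g = _](mulVg (rho (affine w b))).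
  move: aA b'A => /= /and4P[? ? ? _] /and4P[? ? ? _].
  apply: (freiman_word32 rho_hom) => /=; try by apply/and5P; split=> //; apply/andP.
  by rewrite ea eb affine_div mulVg mulg1 affineM mulg1; congr affine; rewrite /= mul1r.
have phi_inj : injective phi.
  move=> n m; have [a1 [a2 [a3 [aA ea ->]]]] := phiP n.
  have [b1 [b2 [b3 [bA eb ->]]]] := phiP m => e.
  suff : affine (u * l)%g n = affine (u * l)%g m by move=> /affine_inj2[].
  rewrite -ea -eb.
  move: aA bA => /= /and4P[a1A a2A a3A _] /and4P[b1A b2A b3A _].
  rewrite -(rhoK a1) // -(rhoK a2) // -(rhoK a3) // -(rhoK b1) // -(rhoK b2) // -(rhoK b3) //.
  by apply: (freiman_word3 sigma_hom) => //=; rewrite !rhoB.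
pose v t := ((phi 0)^-1 * phi t)%g.
(* [Q] holds for one nonzero difference of elements of X and is closed under adding it; that
   difference generates the additive group, so [Q] holds everywhere. *)
pose Q t := forall n, phi (n + t) = (phi n * v t)%g.
have QI t w : (forall n, phi (n + t) = (phi n * w)%g) -> Q t.
  by move=> h n; rewrite /v -[t in RHS]add0r !h mulKg.
have [x [x' [_ [_ [xX x'X _ _ [x'x _]]]]]] := dilate_difference u sq.
have Qall t : Q t.
  have d0 : x' - x != 0 by rewrite subr_eq0.
  have Qd : Q (x' - x).
    apply: (QI _ ((rho (affine u x))^-1 * rho (affine u (x + (x' - x))))%g) => n.
    by apply: phi_shift; rewrite ?addrNK ?[x + _]addrC ?subrK; move: xX x'X; rewrite !inE.
  have [k ->] := Fp_natmul t d0; elim: k => [|k IH].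
    by apply: (QI _ 1%g) => n; rewrite mulr0n addr0 mulg1.
  apply: (QI _ (v (x' - x) * v ((x' - x) *+ k))%g) => n.
  by rewrite mulrS addrA (IH (n + (x' - x))) (Qd n) -mulgA.
exists v; split.
- by move=> s t /mulgI/phi_inj.
- by move=> s t; rewrite /v Qall mulgA.
- by move=> w b t bA btA; rewrite /v -[t in RHS]add0r (phi_shift w b) // mulKg.
Qed.

(* An element of A acts by conjugation on the translations v t, multiplying t by its slope; the
   elements of G acting by distinct scalars form disjoint sets of size at least p. *)
Lemma slope_group :
  exists Lam : {group {unit 'F_p}},
    (forall u b, affine u b \in A -> u \in Lam) /\ (#|Lam| * #|'F_p| <= #|G|)%N.
Proof.
have [v [v_inj vD vA]] := translation_model.
have [u0 [_ sq]] := large_fiber AY big.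
have v0 : v 0 = 1%g by apply: (mulgI (v 0)); rewrite -vD addr0 mulg1.
have vX t k : v (t *+ k) = (v t ^+ k)%g.
  by elim: k => [|k IH]; rewrite ?mulr0n ?v0 // mulrS vD IH expgS.
pose Lam := [set l : {unit 'F_p} | [exists g, [forall t, (v t ^ g)%g == v (val l * t)]]].
have Lam_group : group_set Lam.
  apply/group_setP; split.
    by rewrite inE; apply/existsP; exists 1%g; apply/forallP=> t; rewrite conjg1 mul1r.
  move=> l m; rewrite !inE => /existsP[g /forallP gl] /existsP[h /forallP hm].
  apply/existsP; exists (g * h)%g; apply/forallP=> t.
  by rewrite conjgM (eqP (gl t)) (eqP (hm _)) /= mulrA [val m * _]mulrC.
exists (Group Lam_group); split.
  move=> u b uA; rewrite inE; apply/existsP; exists (rho (affine u b)); apply/forallP=> t.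
  have [x [x' [y [y' [xX x'X yX y'X [x'x e]]]]]] := dilate_difference u sq.
  move: xX x'X yX y'X; rewrite !inE => xX x'X yX y'X.
  have d0 : x' - x != 0 by rewrite subr_eq0.
  (* Since x' - x generates the additive group, it is enough to conjugate [v] at this one point,
     chosen so that its multiple by u is again a difference in X. *)
  suff vd : (v (x' - x) ^ rho (affine u b))%g = v (val u * (x' - x)).
    by have [k ->] := Fp_natmul t d0; rewrite mulrnAr !vX conjXg vd.
  have ex : x + (x' - x) = x' by rewrite addrC subrK.
  have ey : y + val u * (x' - x) = y' by rewrite -e addrC subrK.
  rewrite -(vA u0 x) ?ex // -(vA u0 y) ?ey // conjgE !mulgA.
  (* Inserting rho(a)^-1 rho(a) in the middle of the right side gives both sides the pattern of
     [freiman_word4]. *)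
  rewrite -[X in _ = (X * _)%g](mulgKV (rho (affine u b))).
  apply: (freiman_word4 rho_iso.1) => /=.
  - by rewrite xX x'X uA.
  - by rewrite yX y'X uA.
  rewrite mulgKV -ey affine_div -(affine_conj _ b) -(affine_div u0 x) ex conjgE.
  by rewrite !mulgA.
have /fin_all_exists[g gP] l : exists g, l \in Lam -> forall t, (v t ^ g)%g = v (val l * t).
  have [|/negP nl] := boolP (l \in Lam); last by exists 1%g.
  by rewrite inE => /existsP[g /forallP gl]; exists g => _ t; exact/eqP.
pose f (z : {unit 'F_p} * 'F_p) := (v z.2 * g z.1)%g.
(* The translations commute, so the factor v s acts trivially and f(l, s) still acts as
   multiplication by l. *)
have act l s t : l \in Lam -> (v t ^ f (l, s))%g = v (val l * t).
  move=> lL; rewrite /f /= conjgM -(gP l lL); congr (_ ^ _)%g.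
  by rewrite conjgE -vD addrC vD mulKg.
rewrite -[#|'F_p|]cardsT -cardsX -(card_in_imset (f := f)) ?max_card //.
move=> [l s] [m t] /setXP[lL _] /setXP[mL _] e.
have elm : l = m.
  apply: val_inj => /=; move: (act l s 1 lL); rewrite e act // => /v_inj.
  by rewrite !mulr1.
by move: e; rewrite elm /f /= => /mulIg/v_inj ->.
Qed.

End Model.

(** * Geometric progressions of slopes and the size of A *)

(** If g^i lies in L, then i is a multiple of the index d of L, which leaves at most (m - 1) %/ d +
    1 exponents. As there are at least two, the quotient is positive and the extra 1 is absorbed by
    the factor 2. *)
Lemma card_powers_in_subgroup (gT : finGroupType) (g : gT) (L : {group gT}) (m : nat) :
  L \subset <[g]>%g -> (1 < #|[set i : 'I_m | (g ^+ i)%g \in L]|)%N ->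
  (#|[set i : 'I_m | (g ^+ i)%g \in L]| * #[g]%g <= 2 * m * #|L|)%N.
Proof.
move=> Lg; set I := [set i | _] => I1; set d := (#[g]%g %/ #|L|)%N.
have gdL : (#[g]%g = d * #|L|)%N by rewrite divnK // cardSg.
have d0 : (0 < d)%N by move: (order_gt0 g); rewrite gdL muln_gt0 => /andP[].
have dI (i : 'I_m) : i \in I -> (d %| i)%N.
  rewrite inE => iL; rewrite -(dvdn_pmul2r (cardG_gt0 L)) -gdL order_dvdn expgM.
  by rewrite -order_dvdn order_dvdG.
have leI : (#|I| <= (m.-1 %/ d).+1)%N.
  pose f (i : 'I_m) : 'I_((m.-1 %/ d).+1) := inord (i %/ d).
  have fE (i : 'I_m) : f i = (i %/ d)%N :> nat.
    by rewrite inordK // ltnS leq_div2r //; case: (m) i => [[]|k i] //=; rewrite -ltnS.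
  rewrite -(card_in_imset (f := f)); first by rewrite -[X in (_ <= X)%N]card_ord max_card.
  move=> i j /dI di /dI dj e; apply: val_inj => /=.
  by rewrite -(divnK di) -(divnK dj) -!fE e.
rewrite gdL mulnA leq_mul2r; apply/orP; right.
have dm : (m.-1 %/ d * d <= m.-1)%N by exact: leq_trunc_div.
have : (#|I| * d <= 2 * (m.-1 %/ d * d))%N.
  by rewrite mulnA leq_mul2r mul2n -addnn; move: I1 leI; lia.
lia.
Qed.

Lemma affine_progression (p m : nat) : prime p -> (2 < p)%N -> (0 < m < p)%N ->
  exists Astar : {set {perm 'F_p}},
    [/\ #|Astar| = (m * p)%N, (#|(Astar * Astar)%g| < 2 * #|Astar|)%N
      & forall A : {set {perm 'F_p}}, A \subset Astar -> (p ^ 3 * m ^ 2 < #|A| ^ 3)%N ->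
          forall (G : finGroupType) (B : {set G}) (rho : {perm 'F_p} -> G),
            freiman_iso 5 A B rho -> (#|A| * p.-1 <= 2 * m * #|G|)%N].
Proof.
move=> p_pr p2 /andP[m0 mp]; have cF := card_Fp p_pr.
have /cyclicP[g gen] := field_unit_group_cyclic [set: {unit 'F_p}].
have og : #[g]%g = p.-1 by rewrite orderE -gen card_finField_unit cF.
pose f k (z : 'I_k * 'F_p) := affine (g ^+ z.1)%g z.2.
pose S k := f k @: setT.
have finj : injective (f m).
  move=> [i b] [j c] /affine_inj2[/= /eqP + ->].
  rewrite eq_expg_mod_order og !modn_small; first by move=> /eqP/val_inj ->.
  - by apply: leq_trans (ltn_ord j) _; lia.
  - by apply: leq_trans (ltn_ord i) _; lia.
have cX k : #|[set: 'I_k * 'F_p]| = (k * p)%N by rewrite cardsT card_prod card_ord cF.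
have cardS : #|S m| = (m * p)%N by rewrite card_imset // cX.
exists (S m); split=> //.
  rewrite cardS; apply: (@leq_ltn_trans ((2 * m).-1 * p)); last first.
    by rewrite mulnA ltn_mul2r prime_gt0 //; lia.
  rewrite -cX; apply: leq_trans (leq_imset_card (f _) _); apply: subset_leq_card.
  apply/subsetP=> _ /mulsgP[_ _ /imsetP[[i b] _ ->] /imsetP[[j c] _ ->] ->].
  (* Slope exponents of products range over 0, ..., 2m - 2, so the product set has at most (2m - 1)
     p elements. *)
  have ij : (i + j < (2 * m).-1)%N by move: (ltn_ord i) (ltn_ord j); lia.
  rewrite /f /= affineM -expgD.
  by apply/imsetP; exists (Ordinal ij, val (g ^+ j)%g * b + c); rewrite ?in_setT.
move=> A AS big G B rho iso.
pose Y := [set (g ^+ i)%g | i : 'I_m].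
have AY a : a \in A -> exists u b, u \in Y /\ a = affine u b.
  move=> /(subsetP AS)/imsetP[[i b] _ ->]; exists (g ^+ i)%g, b; split=> //.
  exact: imset_f.
have Ym : (#|Y| <= m)%N by apply: leq_trans (leq_imset_card _ _) _; rewrite card_ord.
have bigY : (#|'F_p| ^ 3 * #|Y| ^ 2 < #|A| ^ 3)%N.
  by apply: leq_ltn_trans big; rewrite cF leq_mul2l leq_exp2r // Ym orbT.
have [Lam [ALam cardG]] := slope_group AY bigY iso.
pose I := [set i : 'I_m | (g ^+ i)%g \in Lam].
have AI : (#|A| <= #|I| * p)%N.
  have -> : (#|I| * p = #|setX I [set: 'F_p]|)%N by rewrite cardsX cardsT cF.
  apply: leq_trans (leq_imset_card (f _) _).
  apply/subset_leq_card/subsetP=> a aA; have /imsetP[[i b] _ ea] := subsetP AS a aA.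
  apply/imsetP; exists (i, b) => //; rewrite !inE andbT; apply: (ALam _ b).
  by rewrite -[affine _ _]/(f m (i, b)) -ea.
(* More than p elements cannot share one exponent, which gives the two exponents required by
   [card_powers_in_subgroup]. *)
have pA : (p < #|A|)%N.
  rewrite -(@ltn_exp2r _ _ 3) //; apply: leq_ltn_trans big.
  by rewrite leq_pmulr // expn_gt0 m0.
have I1 : (1 < #|I|)%N.
  by rewrite -(ltn_pmul2r (prime_gt0 p_pr)) mul1n; exact: leq_trans AI.
have Lg : Lam \subset <[g]>%g by rewrite -gen subsetT.
have := card_powers_in_subgroup Lg I1; rewrite -/I og => cI.
apply: leq_trans (leq_mul AI (leqnn _)) _; rewrite mulnAC.
apply: leq_trans (leq_mul cI (leqnn p)) _; rewrite -mulnA leq_mul2l; apply/orP; right.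
by move: cardG; rewrite cF.
Qed.

(** * Noncommutativity, choice of parameters and the final bound *)

Lemma perm_Fp_nonabelian p : prime p -> (2 < p)%N -> ~~ abelian [set: {perm 'F_p}].
Proof.
move=> p_pr p2; have := card_Fp p_pr => cF.
have [u u1] : exists u : {unit 'F_p}, u != 1%g.
  have : (1 < #|[set: {unit 'F_p}]|)%N by rewrite card_finField_unit cF; lia.
  by rewrite cardG_gt1 => /trivgPn[u _]; exists u.
apply: contra u1 => /centsP/(_ (affine 1%g 1) (in_setT _) (affine u 0) (in_setT _)).
rewrite /commute !affineM => /affine_inj2[_].
by rewrite /= mulr1 addr0 mulr0 add0r => e; apply/eqP/val_inj.
Qed.

(* The exponent b = 5/(3(1-e)) - 1 balances the two constraints: (1+b)(1-e) = 5/3 makes A large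
   enough for the model, and then 1 - b = (1+b)(1-6e)/5 is the gain. *)
Lemma affine_parameters (R : realType) (n : nat) (e : R) : 0 < e < 1 / 6 ->
  exists p m : nat, [/\ prime p, (maxn 2 n < p)%N, (0 < m < p)%N,
    p%:R ^+ 3 * m%:R ^+ 2 < ((m * p)%:R `^ (1 - e)) ^+ 3 :> R
    & m%:R * (m * p)%:R `^ ((1 - 6 * e) / 5) <= p%:R :> R].
Proof.
move=> /andP[e0 e6]; pose b : R := 5 / (3 * (1 - e)) - 1.
have e1 : 1 - e != 0 by rewrite gt_eqF //; lra.
have e1' : 0 < (1 - e)^-1 by rewrite invr_gt0; lra.
have einv : (1 - e) * (1 - e)^-1 = 1 by rewrite divff.
have bE : b = 5 / 3 * (1 - e)^-1 - 1 by rewrite /b invfM mulrA.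
have b0 : 0 < b by rewrite bE; nra.
have b1 : b < 1 by rewrite bE; nra.
have bgain : (1 + b) * ((1 - 6 * e) / 5) = 1 - b by rewrite bE; nra.
have bmodel : (1 + b) * (1 - e) = 5 / 3 by rewrite bE; nra.
clear bE; clearbody b.
(* Taking p > z gives p^(2 - 2b) > 8, which pays for the loss of 1/2, cubed, caused by rounding p^b
   down to m. *)
pose z : R := 8 `^ (2 - 2 * b)^-1.
have [p pbig p_pr] := prime_above (maxn (maxn 2 n) (Num.truncn z).+1).
move: pbig; rewrite gtn_max => /andP[pn pz].
have p0 : 0 < p%:R :> R by rewrite ltr0n prime_gt0.
have p1 : 1 < p%:R :> R by rewrite ltr1n prime_gt1.
have zp : z < p%:R.
  by apply: lt_trans (truncnS_gt z) _; rewrite ltr_nat.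
pose w : R := p%:R `^ b; pose m := Num.truncn w.
have w1 : 1 <= w by rewrite /w -[leLHS](powRr0 p%:R); apply: ler_powR; exact: ltW.
have wp : w < p%:R.
  by rewrite /w -[ltRHS]powRr1 ?(ltW p0) // /powR !gt_eqF // ltr_expR ltr_pM2r // ln_gt0.
have mw : m%:R <= w by rewrite truncn_le // (le_trans _ w1).
have m0 : (0 < m)%N by rewrite truncn_gt0.
have m1 : 1 <= m%:R :> R by rewrite ler1n.
have wm : w < m%:R + 1 by rewrite natr1 truncnS_gt.
have w2m : w / 2 <= m%:R by lra.
have wpE : w * p%:R = p%:R `^ (1 + b).
  by rewrite /w powRD ?(gt_eqF p0) ?implybT // powRr1 ?(ltW p0) // mulrC.
have mpE : (m * p)%:R <= p%:R `^ (1 + b) :> R by rewrite natrM -wpE ler_pM2r.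
exists p, m; split=> //.
- by rewrite m0 -(ltr_nat R); apply: le_lt_trans mw wp.
- have h : p%:R `^ (1 + b) / 2 <= (m * p)%:R by rewrite natrM -wpE mulrAC ler_pM2r.
  have h2 : p%:R `^ (5 / 3) / 2 <= (m * p)%:R `^ (1 - e) :> R.
    apply: le_trans (ge0_ler_powR _ _ _ h); rewrite ?nnegrE; [|lra|..|].
    + rewrite powRM ?powR_ge0 ?invr_ge0 // -powRrM bmodel ler_pM2l ?powR_gt0 //.
      apply: (@ger1_powR R 2^-1 (1 - e)) ; lra.
    + by rewrite divr_ge0 ?powR_ge0.
    + by [].
  (* It remains to see that 8 m^2 < p^2, which follows from m <= p^b and the choice of z. *)
  have h3 : p%:R ^+ 5 / 8 <= ((m * p)%:R `^ (1 - e)) ^+ 3 :> R.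
    apply: le_trans (lerXn2r 3 _ _ h2); rewrite ?nnegrE ?divr_ge0 ?powR_ge0 //.
    rewrite expr_div_n -(@powR_mulrn R (p%:R `^ (5 / 3)) 3) ?powR_ge0 // -powRrM divfK //.
    by rewrite (@powR_mulrn R p%:R 5) ?(ltW p0) // -(natrX R 2 3) lexx.
    by rewrite pnatr_eq0.
  apply: lt_le_trans h3.
  have : 8 < p%:R `^ (2 - 2 * b).
    have <- : z `^ (2 - 2 * b) = 8 by rewrite /z -powRrM mulVf ?powRr1 // gt_eqF //; lra.
    by apply: gt0_ltr_powR; rewrite ?nnegrE ?powR_ge0 ?(ltW p0) //; lra.
  have -> : p%:R `^ (2 - 2 * b) = p%:R ^+ 2 / w ^+ 2.
    rewrite powRB ?(gt_eqF p0) ?implybT // (@powR_mulrn R p%:R 2) ?(ltW p0) //.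
    by rewrite (mulrC 2 b) powRrM (@powR_mulrn R w 2) ?powR_ge0.
  rewrite ltr_pdivlMr ?exprn_gt0 ?(lt_le_trans _ w1) // => w8.
  rewrite ltr_pdivlMr // -mulrA (exprD _ 3 2) ltr_pM2l ?exprn_gt0 //.
  apply: le_lt_trans w8; rewrite mulrC ler_pM2l // lerXn2r ?nnegrE //; lra.
- apply: (@le_trans _ _ (w * p%:R `^ (1 - b))).
    rewrite ler_pM ?powR_ge0 // -bgain powRrM ge0_ler_powR ?nnegrE ?powR_ge0 //; lra.
  by rewrite /w -powRD ?(gt_eqF p0) ?implybT // addrC subrK powRr1 ?(ltW p0).
Qed.

Theorem theorem4 (R : realType) :
  exists2 C : R, 0 < C &
  forall (n : nat) (eps : R), (0 < n)%N -> 0 < eps < 1 / 6 ->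
  exists (H : finGroupType) (Astar : {set H}),
    [/\ ~~ abelian [set: H],
        (n < #|Astar|)%N /\ (#|(Astar * Astar)%g| < 2 * #|Astar|)%N
      & forall A : {set H}, A \subset Astar ->
          #|Astar|%:R `^ (1 - eps) <= #|A|%:R :> R ->
          forall G : finGroupType,
            (exists (B : {set G}) (rho : H -> G), freiman_iso 5 A B rho) ->
            C * #|A|%:R `^ (1 + (1 - 6 * eps) / 5) <= #|G|%:R :> R].
Proof.
(* One factor 2 comes from the bound |A| (p - 1) <= 2 m |G|, the other from p <= 2 (p - 1). *)
exists (1 / 4); first by lra.
move=> n eps n0 eps6.
have [p [m [p_pr]]] := affine_parameters n eps6.
rewrite gtn_max => /andP[p2 np] mp large gain.
have [Astar [cardA doubling model]] := affine_progression p_pr p2 mp.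
move/andP: mp => [m0 mp].
exists {perm 'F_p}, Astar; split; first exact: perm_Fp_nonabelian.
  by split=> //; rewrite cardA; apply: leq_trans np _; rewrite leq_pmull.
move=> A AS Aeps G [B [rho iso]]; rewrite cardA in Aeps.
have Amp : (#|A| <= m * p)%N by rewrite -cardA subset_leq_card.
have big : (p ^ 3 * m ^ 2 < #|A| ^ 3)%N.
  rewrite -(ltr_nat R) natrM !natrX; apply: lt_le_trans large _.
  by rewrite lerXn2r ?nnegrE ?powR_ge0.
have := model A AS big G B rho iso; rewrite -(ler_nat R) !natrM => cardG.
have A0 : (0 < #|A|)%N by case: (#|A|) big.
have A0R : 0 < #|A|%:R :> R by rewrite ltr0n.
rewrite powRD ?(gt_eqF A0R) ?implybT // powRr1 ?(ltW A0R) //.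
set d := (1 - 6 * eps) / 5 in gain *.
have Ad : #|A|%:R `^ d <= (m * p)%:R `^ d.
  by rewrite ge0_ler_powR ?nnegrE ?ler_nat // /d; move: eps6; lra.
have pp : p%:R <= 2 * p.-1%:R :> R by rewrite -natrM ler_nat; move: p2; lia.
have m0R : 0 < m%:R :> R by rewrite ltr0n.
(* With d the gain exponent, m |A|^d <= p, so m |A|^(1 + d) <= |A| p <= 2 |A| (p - 1) <= 4 m |G|. *)
have : m%:R * (#|A|%:R * #|A|%:R `^ d) <= m%:R * (4 * #|G|%:R) :> R.
  rewrite mulrCA; apply: (@le_trans _ _ (#|A|%:R * (2 * p.-1%:R))); last by lra.
  by rewrite ler_pM2l // (le_trans _ pp) // (le_trans _ gain) // ler_pM2l.
by rewrite ler_pM2l //; lra.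
Qed.
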